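(* Let $A$ be a Banach algebra with a bounded approximate identity (bai), $\eta$ an infinite cardinal and $X_1,\dots,X_m$ subsets of $LUC(A)^*$, each of cardinality at least $\eta$; put $X=\bigcup_{k=1}^mX_k$. Suppose that $A$ has the $\eta$-Mazur property and that $A^*$ has the $\eta$-factorization property through $\prod_{k=1}^mX_k$. Then: (1) for every weak$^*$-closed subsemigroup $\mathscr S$ of $LUC(A)^*$ with $X\subseteq\mathscr S$, one has $T_1Z(\mathscr S)=\mathscr S\cap I(A)$, where $I(A)=\{\Psi\in LUC(A)^*: A\Psi\subseteq A\}$; (2) if in addition the bai is bounded by $1$, then $T_1Z(\mathscr S)$ is isometrically isomorphic to $\mathscr S\cap M_r(A)$; (3) in particular, if the bai is bounded by $1$, then $T_1Z(LUC(A)^* )$ is isometrically isomorphic to the right multiplier algebra $M_r(A)$.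
   Context: Module actions. For a Banach algebra $A$, $S\in A^*$, $a,b\in A$: $\langle S\cdot a,b\rangle=\langle S,ab\rangle$. $LUC(A)$ is the closed linear span of $A^*\cdot A=\{S\cdot a\}$ in $A^*$. $LUC(A)^*$ acts on $A^*$ by $\langle\Psi\cdot S,a\rangle=\langle\Psi,S\cdot a\rangle$; this maps $LUC(A)$ into itself, and $LUC(A)^*$ is a Banach algebra with the (first Arens) product $\langle\Phi\Psi,S\rangle=\langle\Phi,\Psi\cdot S\rangle$ ($S\in LUC(A)$). Elements of $A$ are regarded as elements of $LUC(A)^*$ by evaluation. Topological centre. For a subsemigroup $\mathscr S$ of $LUC(A)^*$, $T_1Z(\mathscr S)$ is the set of $\Psi\in\mathscr S$ such that $\Phi\mapsto\Psi\Phi$, $\mathscr S\to\mathscr S$, is weak$^*$-weak$^*$-continuous. Right multipliers. $M_r(A)$ is the algebra of bounded operators $R$ on $A$ with $R(ab)=aR(b)$, with product $R_1R_2=R_2\circ R_1$. When $A$ has a bai bounded by $1$, $M_r(A)$ is identified isometrically with the subalgebra $I(A)$ of $LUC(A)^*$ via $\Phi\in I(A)\mapsto R_\Phi$, $R_\Phi(a)=a\Phi$; this is how $\mathscr S\cap M_r(A)$ is understood. $\eta$-factorization property. $A^*$ has the $\eta$-factorization property through $\prod_{k=1}^mX_k$ if for every bounded family $\{S_\lambda:\lambda<\eta\}$ in $A^*$ there exist a bounded family $\{(\Psi_{\lambda k})_{k=1}^m:\lambda<\eta\}$ in $\prod_{k=1}^mX_k$ and $T_1,\dots,T_m\in A^*$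 such that $S_\lambda=\sum_{k=1}^m\Psi_{\lambda k}\cdot T_k$ for all $\lambda<\eta$. $\eta$-Mazur property. For a Banach space $E$, a functional $\Psi\in E^{**}$ is $\eta$-weak$^*$-continuous if for every infinite net $(S_\lambda)_\lambda$ in the unit ball of $E^*$ of cardinality at most $\eta$ with $S_\lambda\to0$ weak$^*$, one has $\langle\Psi,S_\lambda\rangle\to0$. $E$ has the $\eta$-Mazur property if every $\eta$-weak$^*$-continuous $\Psi\in E^{**}$ belongs to $E$. *)

(* Defs.v *)
From HB Require Import structures.
From mathcomp Require Import all_boot all_order all_algebra.
From mathcomp Require Import complex.
From mathcomp Require Import all_classical all_reals all_analysis.

Set Implicit Arguments.
Unset Strict Implicit.
Unset Printing Implicit Defensive.

Import Order.TTheory GRing.Theory Num.Theory.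
Import numFieldNormedType.Exports.

Local Open Scope classical_set_scope.
Local Open Scope card_scope.
Local Open Scope complex_scope.
Local Open Scope ring_scope.

(* Scalars are complex. The norm of a normedModType over R[i] takes its values
   in R[i] (they are real and nonnegative there). *)

Section ComplexNorm.
Variables (R : realType) (V : normedModType R[i]).
Implicit Types x : V.

Lemma norm_ReE x : `|x| = (complex.Re `|x|)%:C.
Proof. by apply: esym; apply: RRe_real; exact: normr_real. Qed.

Lemma Re_norm_ge0 x : 0 <= complex.Re `|x|.
Proof. by rewrite -lecR -norm_ReE normr_ge0. Qed.

End ComplexNorm.

Section BoundedOperators.
Variables (R : realType) (V W : normedModType R[i]).

Definition bounded_linear : {pred V -> W} :=
  fun f => `[< linear f /\ continuous f >].

Lemma bounded_linear_submod : submod_closed bounded_linear.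
Proof.
split.
  apply/asboolP; split=> [k x y|x]; first by rewrite /= scaler0 addr0.
  exact: cst_continuous.
move=> k f g /asboolP[lf cf] /asboolP[lg cg]; apply/asboolP; split.
  move=> a x y.
  rewrite -[LHS]/(k *: f (a *: x + y) + g (a *: x + y)).
  rewrite -[RHS]/(a *: (k *: f x + g x) + (k *: f y + g y)).
  by rewrite lf lg !scalerDr !scalerA (mulrC k) addrACA.
move=> x; apply: continuousD; last exact: cg.
by apply: continuousZl_tmp; exact: cf.
Qed.

HB.instance Definition _ := GRing.isSubmodClosed.Build R[i] (V -> W)
  bounded_linear bounded_linear_submod.

Record bop := Bop { bop_fun :> V -> W ; bop_funP : bop_fun \in bounded_linear }.

HB.instance Definition _ := [isSub for bop_fun].
HB.instance Definition _ := [Choice of bop by <:].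
HB.instance Definition _ := [SubChoice_isSubLmodule of bop by <:].

Lemma bop_linear (f : bop) : linear f.
Proof. by case: f => f /= /asboolP[]. Qed.

Lemma bop_continuous (f : bop) : continuous f.
Proof. by case: f => f /= /asboolP[]. Qed.

HB.instance Definition _ (f : bop) :=
  GRing.isLinear.Build R[i] V W *:%R f (bop_linear f).

Lemma bop_eqP (f g : bop) : (forall x, f x = g x) -> f = g.
Proof. by move=> fg; apply/val_inj/funext. Qed.

Lemma bop0E x : (0 : bop) x = 0. Proof. by []. Qed.

Lemma bopDE (f g : bop) x : (f + g) x = f x + g x. Proof. by []. Qed.

Lemma bopZE k (f : bop) x : (k *: f) x = k *: f x. Proof. by []. Qed.

Lemma bounded_linearP (f : V -> W) (M : R[i]) : linear f ->
  M \is Num.real -> (forall x, `|f x| <= M * `|x|) -> f \in bounded_linear.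
Proof.
move=> lf MR fM; apply/asboolP; split=> //.
pose g : {linear V -> W} := HB.pack f (GRing.isLinear.Build R[i] V W *:%R f lf).
apply: (@bounded_linear_continuous _ _ _ g); apply/linear_boundedP.
exists M; split=> // r Mr x; apply: (le_trans (fM x)).
by rewrite ler_wpM2r// ltW.
Qed.

Lemma bop_bounded (f : bop) : exists M : R, forall x, `|f x| <= M%:C * `|x|.
Proof.
have := @continuous_linear_bounded _ _ _ 0 f (@bop_continuous f 0).
move=> /linear_boundedP[M [MR fM]].
exists (complex.Re M + 1) => x; apply: fM.
by rewrite rmorphD/= (RRe_real MR) ltrDl ltr01.
Qed.

(* The supremum is taken in R; the R[i]-valued norm is bop_norm below. *)
Definition opnorm (f : bop) : R :=
  sup [set complex.Re `|f x| | x in [set x | `|x| <= 1]].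

Lemma opnorm_has_sup (f : bop) :
  has_sup [set complex.Re `|f x| | x in [set x | `|x| <= 1]].
Proof.
split; first by exists (complex.Re `|f 0|); exists 0 => //=; rewrite normr0.
have [M fM] := bop_bounded f; exists `|M| => _ [x /= x1 <-].
rewrite -lecR -norm_ReE (le_trans (fM x))//.
apply: (@le_trans _ _ (`|M|%:C * `|x|)).
  by rewrite ler_wpM2r// lecR ler_norm.
by rewrite ler_piMr// -[0]/(0%:C) lecR.
Qed.

Lemma opnorm_ge0 (f : bop) : 0 <= opnorm f.
Proof.
apply: (@le_trans _ _ (complex.Re `|f 0|)); first exact: Re_norm_ge0.
apply: ub_le_sup; first by case: (opnorm_has_sup f).
by exists 0 => //=; rewrite normr0.
Qed.

Lemma le_opnorm (f : bop) x : `|f x| <= (opnorm f)%:C * `|x|.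
Proof.
have [->|x0] := eqVneq x 0; first by rewrite linear0 !normr0 mulr0.
have nx0 : `|x| != 0 by rewrite normr_eq0.
have nx1 : `| `|x|^-1 *: x| = 1.
  by rewrite normrZ normfV normr_id mulVf.
have : complex.Re `|f (`|x|^-1 *: x)| <= opnorm f.
  apply: ub_le_sup; first by case: (opnorm_has_sup f).
  by exists (`|x|^-1 *: x) => //=; rewrite nx1.
rewrite -lecR -norm_ReE linearZ/= normrZ normfV normr_id.
by rewrite ler_pdivrMl ?normr_gt0// mulrC.
Qed.

Lemma opnorm_le (f : bop) (M : R) : 0 <= M ->
  (forall x, `|f x| <= M%:C * `|x|) -> opnorm f <= M.
Proof.
move=> M0 fM; apply: ge_sup; first by case: (opnorm_has_sup f).
move=> _ [x /= x1 <-]; rewrite -lecR -norm_ReE (le_trans (fM x))//.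
by rewrite ler_piMr// -[0]/(0%:C) lecR.
Qed.

Definition bop_norm (f : bop) : R[i] := (opnorm f)%:C.

Lemma bop_normD f g : bop_norm (f + g) <= bop_norm f + bop_norm g.
Proof.
rewrite /bop_norm -rmorphD lecR; apply: opnorm_le.
  by rewrite addr_ge0 ?opnorm_ge0.
move=> x; rewrite bopDE (le_trans (ler_normD _ _))//.
by rewrite rmorphD mulrDl lerD ?le_opnorm.
Qed.

Lemma bop_normZ_le k f : bop_norm (k *: f) <= `|k| * bop_norm f.
Proof.
have kE : `|k| = (complex.Re `|k|)%:C.
  by apply: esym; apply: RRe_real; exact: normr_real.
have k0 : 0 <= complex.Re `|k| by rewrite -lecR -kE normr_ge0.
rewrite /bop_norm kE -rmorphM lecR; apply: opnorm_le.
  by rewrite mulr_ge0 ?opnorm_ge0.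
move=> x; rewrite bopZE normrZ rmorphM/= -mulrA {1}kE ler_wpM2l//.
  by rewrite -[0]/(0%:C) lecR.
exact: le_opnorm.
Qed.

Lemma bop_normZ k f : bop_norm (k *: f) = `|k| * bop_norm f.
Proof.
apply/eqP; rewrite eq_le bop_normZ_le/=.
have [->|k0] := eqVneq k 0.
  by rewrite normr0 mul0r /bop_norm -[0]/(0%:C) lecR opnorm_ge0.
rewrite -[X in _ * bop_norm X](scalerK k0) -ler_pdivlMl ?normr_gt0// -normfV.
exact: bop_normZ_le.
Qed.

Lemma bop_norm0_eq0 f : bop_norm f = 0 -> f = 0.
Proof.
move=> f0; apply: bop_eqP => x; apply/normr0_eq0/eqP.
rewrite eq_le normr_ge0 andbT (le_trans (le_opnorm f x))//.
by rewrite -[(_)%:C]/(bop_norm f) f0 mul0r.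
Qed.

HB.instance Definition _ :=
  Lmodule_isNormed.Build R[i] bop bop_normD bop_normZ bop_norm0_eq0.

Lemma le_bop_norm (f : bop) x : `|f x| <= `|f| * `|x|.
Proof. exact: le_opnorm. Qed.

End BoundedOperators.

Section Composition.
Variables (R : realType) (U V W : normedModType R[i]).

Lemma bop_comp_subproof (g : bop V W) (f : bop U V) :
  (g \o f) \in bounded_linear (V := U) (W := W).
Proof.
apply/asboolP; split=> [k x y|x]; first by rewrite /= !linearP.
by apply: continuous_comp; exact: bop_continuous.
Qed.

Definition bop_comp g f : bop U W := Bop (bop_comp_subproof g f).

End Composition.

Notation dual_space V := (bop V (complex _)^o).

Definition weakstar (R : realType) (V : normedModType R[i]) :=
  initial_topology (fun f : dual_space V => (f : {ptws V -> R[i]^o})).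
HB.instance Definition _ (R : realType) (V : normedModType R[i]) :=
  Topological.on (weakstar V).

Lemma weakstar_cvgP (R : realType) (V : normedModType R[i])
    (F : set_system (dual_space V)) (f : dual_space V) : Filter F ->
  F --> (f : weakstar V) <->
  forall x, (fun g : dual_space V => g x : R[i]^o) @ F --> (f x : R[i]^o).
Proof.
move=> FF; split=> [Ff x|Ff].
  have cf := @initial_continuous (dual_space V) {ptws V -> R[i]^o}
    (fun f => f : {ptws V -> R[i]^o}) f.
  have : (fun g : dual_space V => (g : V -> R[i]^o)) @ F -->
         ((f : V -> R[i]^o) : {ptws V -> R[i]^o}).
    by move=> B nB; exact: (Ff _ (cf B nB)).
  by move=> /pointwise_cvgP/(_ x).
have H : {ptws, (fun g : dual_space V => (g : V -> R[i]^o)) @ F -->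
                (f : V -> R[i]^o)}.
  by apply/pointwise_cvgP.
move=> B [C [[D oD <-] Df] CB].
by apply: (filterS CB); apply: (H D); exact: open_nbhs_nbhs.
Qed.

Section Nets.
Variables (I : Type) (le : I -> I -> Prop).

Definition directed_set :=
  [/\ inhabited I,
      forall i, le i i,
      forall i j k, le i j -> le j k -> le i k
    & forall i j, exists2 k, le i k & le j k].

(* A net u : I -> T converges to x when u @ tails --> x. *)
Definition tails : set_system I :=
  [set P | exists i, forall j, le i j -> P j].

Lemma tails_proper : directed_set -> ProperFilter tails.
Proof.
move=> [[i1] lexx le_trans le_dir]; split.
  by move=> [i0 ] /(_ i0 (lexx i0)).
split.
- by exists i1.
- move=> P Q [i iP] [j jQ]; have [k ik jk] := le_dir i j.
  by exists k => l kl; split; [apply: iP|apply: jQ]; apply: le_trans kl.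
- by move=> P Q PQ [i iP]; exists i => j /iP/PQ.
Qed.

End Nets.

HB.mixin Record CompleteNormedModule_isBanachAlgebra (R : realType) A
    & CompleteNormedModule R[i] A := {
  amul : A -> A -> A ;
  amulA : associative amul ;
  amulDl : left_distributive amul +%R ;
  amulDr : right_distributive amul +%R ;
  amulZl : forall (k : R[i]) a b, amul (k *: a) b = k *: amul a b ;
  amulZr : forall (k : R[i]) a b, amul a (k *: b) = k *: amul a b ;
  ler_norm_amul : forall a b, `|amul a b| <= `|a| * `|b| }.

(* Banach algebras are not required to have a unit. *)
#[short(type="banachAlgType")]
HB.structure Definition BanachAlgebra (R : realType) :=
  {A of CompleteNormedModule R[i] A & CompleteNormedModule_isBanachAlgebra R A}.

Definition span_set (K : pzRingType) (V : lmodType K) (G : set V) : set V :=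
  [set v | exists n (c : 'I_n -> K) (g : 'I_n -> V),
     (forall i, G (g i)) /\ v = \sum_i c i *: g i].

Lemma span_set_submod (K : pzRingType) (V : lmodType K) (G : set V) :
  span_set G 0 /\
  forall k x y, span_set G x -> span_set G y -> span_set G (k *: x + y).
Proof.
split.
  by exists 0, (fun=> 0), (fun=> 0); split; [case|rewrite big_ord0].
move=> k x y [n [c [g [Gg ->]]]] [p [d [h [Gh ->]]]].
exists (n + p)%N,
  (fun i : 'I_(n + p) => match fintype.split i with inl j => k * c j | inr j => d j end),
  (fun i : 'I_(n + p) => match fintype.split i with inl j => g j | inr j => h j end).
split; first by move=> i; case: splitP => j _.
rewrite big_split_ord/= scaler_sumr; congr (_ + _); apply: eq_bigr => i _.
  by rewrite (unsplitK (inl i)) scalerA.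
by rewrite (unsplitK (inr i)).
Qed.

Section ModuleActions.
Variables (R : realType) (A : banachAlgType R).
Implicit Types (S : dual_space A) (a b : A).

Lemma actA_subproof S a :
  (fun b => S (amul a b)) \in bounded_linear (V := A) (W := R[i]^o).
Proof.
apply: (@bounded_linearP _ _ _ _ (`|S| * `|a|)).
- by move=> k x y; rewrite amulDr amulZr linearP.
- by rewrite realM ?normr_real.
- move=> b; rewrite (le_trans (le_bop_norm _ _))// -mulrA ler_wpM2l//.
  exact: ler_norm_amul.
Qed.

(* actA S a is S . a *)
Definition actA S a : dual_space A := Bop (actA_subproof S a).

Definition LUC : set (dual_space A) :=
  closure (span_set [set actA S a | S in setT & a in setT]).


Lemma actA_LUC S a : actA S a \in LUC.
Proof.
apply/mem_set/subset_closure; exists 1%N, (fun=> 1), (fun=> actA S a).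
by rewrite big_ord1 scale1r; split=> // _; exists S => //; exists a.
Qed.

Lemma LUC_approxP S :
  LUC S <-> forall e : R[i], 0 < e ->
    exists2 T, span_set [set actA S a | S in setT & a in setT] T & `|S - T| < e.
Proof.
split=> [clS e e0|apS B].
  have [T [GT ST]] := clS (ball S e) (nbhsx_ballx S e e0).
  by exists T => //; move: ST; rewrite -ball_normE.
move=> /nbhs_normP[e /= e0 eB]; have [T GT ST] := apS e e0.
by exists T; split=> //; exact: eB.
Qed.

Definition LUC_pred : {pred dual_space A} := fun S => S \in LUC.

Lemma LUC_submod : submod_closed LUC_pred.
Proof.
have [span0 spanL] :=
  span_set_submod [set actA S a | S in @setT (dual_space A) & a in @setT A].
split; first by apply/mem_set/subset_closure.
move=> k S T /set_mem/LUC_approxP apS /set_mem/LUC_approxP apT.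
apply/mem_set/LUC_approxP => e e0.
have k1 : 0 < `|k| + 1 by rewrite ltr_wpDl.
have [S' GS' SS'] := apS (e / 2 / (`|k| + 1)) ltac:(by rewrite !divr_gt0).
have [T' GT' TT'] := apT (e / 2) ltac:(by rewrite divr_gt0).
exists (k *: S' + T'); first exact: spanL.
rewrite opprD addrACA -scalerBr (le_lt_trans (ler_normD _ _))// normrZ.
rewrite [ltRHS](splitr e) ler_ltD//.
rewrite (@le_trans _ _ ((`|k| + 1) * `|S - S'|))//.
  by rewrite ler_wpM2r// lerDl.
by rewrite -ler_pdivlMl// mulrC ltW.
Qed.

HB.instance Definition _ := GRing.isSubmodClosed.Build R[i] (dual_space A)
  LUC_pred LUC_submod.

Record luc := Luc { luc_val :> dual_space A ; lucP : luc_val \in LUC_pred }.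

HB.instance Definition _ := [isSub for luc_val].
HB.instance Definition _ := [Choice of luc by <:].
HB.instance Definition _ := [SubChoice_isSubLmodule of luc by <:].

Definition luc_norm (S : luc) : R[i] := `|luc_val S|.

Lemma luc_normD (S T : luc) : luc_norm (S + T) <= luc_norm S + luc_norm T.
Proof. exact: ler_normD. Qed.

Lemma luc_normZ k (S : luc) : luc_norm (k *: S) = `|k| * luc_norm S.
Proof. exact: normrZ. Qed.

Lemma luc_norm0_eq0 (S : luc) : luc_norm S = 0 -> S = 0.
Proof. by move=> /normr0_eq0 S0; exact: val_inj. Qed.

HB.instance Definition _ :=
  Lmodule_isNormed.Build R[i] luc luc_normD luc_normZ luc_norm0_eq0.

Definition lucA S a : luc := @Luc (actA S a) (actA_LUC S a).

Lemma actA_norm S a : `|actA S a| <= `|S| * `|a|.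
Proof.
rewrite [leLHS]/(bop_norm _).
have -> : `|S| * `|a| = (opnorm S * complex.Re `|a|)%:C.
  by rewrite rmorphM/= -norm_ReE.
rewrite lecR; apply: opnorm_le.
  by rewrite mulr_ge0 ?opnorm_ge0 ?Re_norm_ge0.
move=> b; rewrite rmorphM/= -norm_ReE -mulrA.
rewrite (le_trans (le_opnorm _ _))// ler_wpM2l//.
  by rewrite -[0]/(0%:C) lecR opnorm_ge0.
exact: ler_norm_amul.
Qed.

Implicit Types (Phi Psi : dual_space luc).

Lemma actD_subproof Psi S :
  (fun a => Psi (lucA S a)) \in bounded_linear (V := A) (W := R[i]^o).
Proof.
apply: (@bounded_linearP _ _ _ _ (`|Psi| * `|S|)).
- move=> k a b; have -> : lucA S (k *: a + b) = k *: lucA S a + lucA S b.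
    by apply/val_inj/bop_eqP => c; rewrite /= amulDl amulZl linearP.
  exact: bop_linear.
- by rewrite realM ?normr_real.
- move=> a; rewrite (le_trans (le_bop_norm _ _))// -mulrA ler_wpM2l//.
  exact: actA_norm.
Qed.

(* actD Psi S is Psi . S *)
Definition actD Psi S : dual_space A := Bop (actD_subproof Psi S).

Lemma actD_norm Psi S : `|actD Psi S| <= `|Psi| * `|S|.
Proof.
rewrite [leLHS]/(bop_norm _).
have -> : `|Psi| * `|S| = (opnorm Psi * opnorm S)%:C by rewrite rmorphM.
rewrite lecR; apply: opnorm_le; first by rewrite mulr_ge0 ?opnorm_ge0.
move=> a; rewrite rmorphM/= -mulrA.
rewrite (le_trans (le_opnorm _ _))// ler_wpM2l//.
  by rewrite -[0]/(0%:C) lecR opnorm_ge0.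
exact: actA_norm.
Qed.

Lemma actD_linear Psi : linear (actD Psi).
Proof.
move=> k S T; apply: bop_eqP => a.
rewrite -[LHS]/(Psi (lucA (k *: S + T) a)).
have -> : lucA (k *: S + T) a = k *: lucA S a + lucA T a.
  by apply/val_inj/bop_eqP.
exact: bop_linear.
Qed.

HB.instance Definition _ Psi :=
  GRing.isLinear.Build R[i] (dual_space A) (dual_space A) *:%R (actD Psi)
    (actD_linear Psi).

Lemma actD_actA Psi S a : actD Psi (actA S a) = actA (actD Psi S) a.
Proof.
apply: bop_eqP => b; rewrite /=; congr (Psi _).
by apply/val_inj/bop_eqP => c; rewrite /= amulA.
Qed.

Lemma actD_LUC Psi S : S \in LUC -> actD Psi S \in LUC.
Proof.
move=> /set_mem/LUC_approxP apS; apply/mem_set/LUC_approxP => e e0.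
have P1 : 0 < `|Psi| + 1 by rewrite ltr_wpDl.
have [T [n [c [g [Gg TE]]]] ST] :=
  apS (e / (`|Psi| + 1)) ltac:(by rewrite divr_gt0).
exists (actD Psi T).
  exists n, c, (fun i => actD Psi (g i)); split.
    move=> i; have [S' _ [a _ <-]] := Gg i.
    by exists (actD Psi S') => //; exists a => //; rewrite actD_actA.
  by rewrite TE linear_sum; apply: eq_bigr => i _; rewrite linearZ.
rewrite -linearB (le_lt_trans (actD_norm _ _))//.
rewrite (@le_lt_trans _ _ ((`|Psi| + 1) * `|S - T|))//.
  by rewrite ler_wpM2r// lerDl.
by rewrite -ltr_pdivlMl// mulrC.
Qed.

Definition actL Psi (S : luc) : luc :=
  @Luc (actD Psi S) (actD_LUC Psi (lucP S)).

Lemma arens_subproof Phi Psi :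
  (fun S : luc => Phi (actL Psi S)) \in bounded_linear (V := luc) (W := R[i]^o).
Proof.
apply: (@bounded_linearP _ _ _ _ (`|Phi| * `|Psi|)).
- move=> k S T; have -> : actL Psi (k *: S + T) = k *: actL Psi S + actL Psi T.
    by apply: val_inj; rewrite /= linearP.
  exact: bop_linear.
- by rewrite realM ?normr_real.
- move=> S; rewrite (le_trans (le_bop_norm _ _))// -mulrA ler_wpM2l//.
  exact: actD_norm.
Qed.

(* the first Arens product on LUC(A)^* *)
Definition arens Phi Psi : dual_space luc := Bop (arens_subproof Phi Psi).

Lemma luc_eval_subproof a :
  (fun S : luc => luc_val S a) \in bounded_linear (V := luc) (W := R[i]^o).
Proof.
apply: (@bounded_linearP _ _ _ _ `|a|).
- by [].
- exact: normr_real.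
- by move=> S; rewrite mulrC; exact: le_bop_norm.
Qed.

(* the element a of A regarded as an element of LUC(A)^* *)
Definition luc_eval a : dual_space luc := Bop (luc_eval_subproof a).

End ModuleActions.

Section TopologicalCentre.
Variables (R : realType) (A : banachAlgType R).
Implicit Types (Sg : set (dual_space (luc A))) (Phi Psi : dual_space (luc A)).

Definition weakstar_closed Sg := closed (Sg : set (weakstar (luc A))).

Definition subsemigroup Sg :=
  forall Phi Psi, Sg Phi -> Sg Psi -> Sg (arens Phi Psi).

Definition T1Z Sg : set (dual_space (luc A)) :=
  [set Psi | Sg Psi /\
    {within (Sg : set (weakstar (luc A))),
       continuous (arens Psi : weakstar (luc A) -> weakstar (luc A))}].

(* I(A) = {Psi : A Psi is contained in A} *)
Definition IA : set (dual_space (luc A)) :=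
  [set Psi | forall a, exists b, arens (luc_eval a) Psi = luc_eval b].

End TopologicalCentre.

Section RightMultipliers.
Variables (R : realType) (A : banachAlgType R).

Definition right_multipliers : set (bop A A) :=
  [set T | forall a b, T (amul a b) = amul a (T b)].

(* the product of M_r(A) is opposite to composition: T1 T2 = T2 \o T1 *)
Definition rmult_mul (T1 T2 : bop A A) : bop A A := bop_comp T2 T1.

(* T is the operator R_Phi : a |-> a Phi; the value a Phi, a priori in
   LUC(A)^*, is the evaluation at the element T a of A. *)
Definition is_rmult_of (Phi : dual_space (luc A)) (T : bop A A) :=
  forall a, arens (luc_eval a) Phi = luc_eval (T a).

(* Sg `&` M_r(A), where M_r(A) is identified with I(A) via Phi |-> R_Phi *)
Definition capMr (Sg : set (dual_space (luc A))) : set (bop A A) :=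
  [set T | right_multipliers T /\
           exists2 Phi, (Sg `&` @IA R A) Phi & is_rmult_of Phi T].

End RightMultipliers.

(* D and E are subsemigroups of normed algebras with products mulV and mulW.
   As D need not be a linear subspace, f is required to preserve the linear
   combinations that stay in D. *)
Definition isometric_isomorphism (R : realType) (V W : normedModType R[i])
    (mulV : V -> V -> V) (mulW : W -> W -> W) (D : set V) (E : set W)
    (f : V -> W) :=
  [/\ set_bij D E f,
      forall x y, D x -> D y ->
        D (mulV x y) /\ f (mulV x y) = mulW (f x) (f y),
      forall (k : R[i]) x y, D x -> D y -> D (k *: x + y) ->
        f (k *: x + y) = k *: f x + f y
    & forall x y, D x -> D y -> `|f x - f y| = `|x - y|].

Definition linear_subspace (K : pzRingType) (V : lmodType K) (D : set V) :=
  D 0 /\ forall (k : K) x y, D x -> D y -> D (k *: x + y).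

Section NetConditions.
Variables (R : realType) (A : banachAlgType R).

Definition bounded_approximate_identity (I : Type) (le : I -> I -> Prop)
    (e : I -> A) :=
  [/\ directed_set le,
      exists M : R, forall i, `|e i| <= M%:C,
      forall a, amul (e i) a @[i --> tails le] --> a
    & forall a, amul a (e i) @[i --> tails le] --> a].

(* The cardinal eta is represented by a type of that cardinality. *)
Definition eta_factorization (eta : Type) (m : nat)
    (X : 'I_m -> set (dual_space (luc A))) :=
  forall S : eta -> dual_space A,
  (exists M : R, forall l, `|S l| <= M%:C) ->
  exists (Psi : eta -> 'I_m -> dual_space (luc A)) (T : 'I_m -> dual_space A),
  [/\ forall l k, X k (Psi l k),
      exists M : R, forall l k, `|Psi l k| <= M%:C
    & forall l, S l = \sum_(k < m) actD (Psi l k) (T k)].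

End NetConditions.

Section Mazur.
Variables (R : realType) (E : normedModType R[i]) (eta : Type).

Definition eta_weakstar_continuous (Psi : dual_space (dual_space E)) :=
  forall (I : Type) (le : I -> I -> Prop) (S : I -> dual_space E),
  directed_set le -> infinite_set [set: I] -> [set: I] #<= [set: eta] ->
  (forall i, `|S i| <= 1) ->
  (S i : weakstar E) @[i --> tails le] -->
    ((0 : dual_space E) : weakstar E) ->
  Psi (S i) @[i --> tails le] --> (0 : R[i]^o).

Definition eta_Mazur :=
  forall Psi, eta_weakstar_continuous Psi ->
  exists x : E, forall S : dual_space E, Psi S = S x.

End Mazur.

(* Main.v *)
(* For Psi in T1Z(Sg) and a in A, the functional S |-> <Psi, S . a> on A^* is
   tested on a weak* null net, which is written through the factorization
   property as sums of Psi_(i,k) . T_k. Along any ultrafilter the bounded nets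
   Psi_(i,k) have weak* limits in Sg, and the continuity of left multiplication
   by Psi shows that the functional tends to 0; the Mazur property then places
   it in A. Conversely, if A Psi is contained in A, left multiplication by Psi
   on LUC(A)^* is the adjoint of an operator on LUC(A), hence weak* continuous.
   With a bai bounded by 1, A embeds isometrically into LUC(A)^* by
   Hahn-Banach, and Psi is recovered from R_Psi as the weak* limit of
   R_Psi (e_i). *)
Require Import Defs.
From mathcomp Require Import all_boot all_order all_algebra.
From mathcomp Require Import complex.
From mathcomp Require Import all_classical all_reals all_analysis.

Set Implicit Arguments.
Unset Strict Implicit.
Unset Printing Implicit Defensive.

Import Order.TTheory GRing.Theory Num.Theory.
Import numFieldNormedType.Exports.

Local Open Scope classical_set_scope.
Local Open Scope card_scope.
Local Open Scope complex_scope.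
Local Open Scope ring_scope.

(** * Complex moduli against real and imaginary parts *)

Section NormPreliminaries.
Context {R : realType}.

Lemma normc_real (k : R) : `|k%:C| = `|k|%:C.
Proof. by rewrite normc_def/= expr0n/= addr0 sqrtr_sqr. Qed.

Lemma ger0_real_complex (z : R[i]) : 0 <= z -> z = (complex.Re z)%:C.
Proof. by move=> z0; rewrite RRe_real// ger0_real. Qed.

Lemma normc_le_ReIm (z : R[i]) :
  `|z| <= (`|complex.Re z| + `|complex.Im z|)%:C.
Proof.
rewrite [z in leLHS]complexE (le_trans (ler_normD _ _))// normrM !normc_real.
by rewrite rmorphD/= normc_def/= expr0n/= add0r expr1n sqrtr1 mul1r.
Qed.

Lemma normc_ge_Im (z : R[i]) : `|complex.Im z|%:C <= `|z|.
Proof.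
by rewrite normc_def lecR -sqrtr_sqr ler_wsqrtr// lerDr sqr_ge0.
Qed.

Lemma bop_norm_le (V W : normedModType R[i]) (f : bop V W) (M : R[i]) :
  0 <= M -> (forall x, `|f x| <= M * `|x|) -> `|f| <= M.
Proof.
move=> M0; rewrite (ger0_real_complex M0) => fM.
rewrite [leLHS]/(bop_norm f) lecR; apply: opnorm_le => //.
by rewrite -ler0c -ger0_real_complex.
Qed.

End NormPreliminaries.

(** * The Hahn-Banach theorem over the complex numbers *)

Section HahnBanach.
Context {R : realType} {V : normedModType R[i]}.
Implicit Types (x y v : V) (G : set (V * R)).

Let N x : R := complex.Re `|x|.

Let ND x y : N (x + y) <= N x + N y.
Proof. by rewrite -lecR rmorphD/= /N -!norm_ReE ler_normD. Qed.

Let NZ (k : R) x : N (k%:C *: x) = `|k| * N x.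
Proof.
by apply: complexI; rewrite rmorphM/= /N -!norm_ReE normrZ normc_real.
Qed.

(* A dominated real-linear functional on a real subspace, given by its graph.
   Single-valuedness follows from the domination by the norm. *)
Let dominated G :=
  (forall (k : R) p q, G p -> G q ->
     G (k%:C *: p.1 + q.1, k * p.2 + q.2)) /\
  (forall p, G p -> p.2 <= N p.1).

Let dominated0 G : dominated G -> G !=set0 -> G (0, 0).
Proof.
move=> [Glin _] [[x r] Gx]; have := Glin (-1) _ _ Gx Gx.
by rewrite /= rmorphN rmorph1 scaleN1r mulN1r !addNr.
Qed.

(** The value [c] at [v] has to lie above all [p.2 - N (p.1 - v)] and below all [N (q.1 + v) - q.2].
    The triangle inequality puts the former below the latter, so their supremum serves. Dividing by
    [t] or [- t] reduces domination at [p.1 + t v] to these two bounds. If [v] already is in the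
    domain, they force the old value, so no case distinction arises. *)
Let extend G v : dominated G -> G !=set0 ->
  exists2 G', dominated G' & G `<=` G' /\ exists c, G' (v, c).
Proof.
move=> domG G0; have [Glin GN] := domG; have G00 := dominated0 domG G0.
pose E := [set p.2 - N (p.1 - v) | p in G].
have Eub q : G q -> ubound E (N (q.1 + v) - q.2).
  move=> Gq _ [p Gp <-]; rewrite lerBlDr addrAC lerBrDr.
  have := GN _ (Glin 1 _ _ Gp Gq); rewrite /= rmorph1 scale1r mul1r => /le_trans.
  apply; rewrite addrC (le_trans _ (ND _ _))// /N.
  by rewrite addrACA [- v + _]addrC subrr addr0 addrC.
have Esup : has_sup E.
  split; first by exists (0 - N (0 - v)), (0, 0).
  by exists (N (0 + v) - 0); exact: (Eub (0, 0)).
pose c := sup E.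
have c1 p : G p -> p.2 - c <= N (p.1 - v).
  move=> Gp; rewrite lerBlDr addrC -lerBlDr; apply: ub_le_sup; first by case: Esup.
  by exists p.
have c2 p : G p -> p.2 + c <= N (p.1 + v).
  move=> Gp; rewrite addrC -lerBrDr; apply: ge_sup; first by case: Esup.
  exact: Eub.
have Gscale k p : G p -> G (k%:C *: p.1, k * p.2).
  by move=> Gp; have := Glin k _ _ Gp G00; rewrite /= !addr0.
exists [set q | exists2 p, G p & exists t : R, q = (p.1 + t%:C *: v, p.2 + t * c)].
  split.
    move=> k _ _ [p Gp [t ->]] [q Gq [s ->]].
    exists (k%:C *: p.1 + q.1, k * p.2 + q.2); first exact: Glin.
    exists (k * t + s); rewrite /= rmorphD rmorphM/= !mulrDr mulrDl.
    by rewrite scalerDr scalerDl scalerA addrACA mulrA; congr pair; rewrite addrACA.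
  move=> _ [p Gp [t ->]] /=.
  have [t0|t0|->] := ltgtP t 0; last first.
  - by rewrite scale0r mul0r !addr0; exact: GN.
  - have := c2 _ (Gscale t^-1 _ Gp); rewrite /= => H.
    have -> : p.1 + t%:C *: v = t%:C *: ((t^-1)%:C *: p.1 + v).
      by rewrite scalerDr scalerA -rmorphM/= divff ?gt_eqF// rmorph1 scale1r.
    rewrite NZ gtr0_norm// -ler_pdivrMl// mulrDr mulrA mulVf ?gt_eqF// mul1r.
    exact: H.
  - have := c1 _ (Gscale (- t)^-1 _ Gp); rewrite /= => H.
    have t1 : 0 < - t by rewrite oppr_gt0.
    have -> : p.1 + t%:C *: v = (- t)%:C *: ((- t)^-1%:C *: p.1 - v).
      rewrite scalerBr scalerA -rmorphM/= divff ?gt_eqF// rmorph1 scale1r.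
      by rewrite rmorphN scaleNr opprK.
    rewrite NZ gtr0_norm// -ler_pdivrMl// mulrDr mulrA.
    by have -> : (- t)^-1 * t = -1; rewrite ?mulN1r// invrN mulNr mulVf ?lt_eqF.
split.
  by move=> p Gp; exists p => //; exists 0; rewrite scale0r mul0r !addr0; case: p Gp.
by exists c, (0, 0) => //; exists 1; rewrite rmorph1 scale1r mul1r !add0r.
Qed.

(** Zorn's lemma gives a maximal dominated graph above the line through [x0]; by [extend] its domain
    is all of [V]. *)
Let real_hahn_banach x0 : exists f : V -> R,
  [/\ forall (k : R) x y, f (k%:C *: x + y) = k * f x + f y,
      forall x, f x <= N x & f x0 = N x0].
Proof.
pose L : set (V * R) := [set (t%:C *: x0, t * N x0) | t in [set: R]].
have domL : dominated L.
  split.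
    move=> k _ _ [t _ <-] [s _ <-]; exists (k * t + s) => //=.
    by rewrite rmorphD rmorphM/= scalerDl scalerA mulrDl mulrA.
  by move=> _ [t _ <-]/=; rewrite NZ ler_wpM2r ?Re_norm_ge0 ?ler_norm.
(* Nonemptiness is a premise so that the union of the empty chain also satisfies [P]; a maximal [G]
   is nonempty because [L] properly contains the empty set. *)
pose P G := G !=set0 -> dominated G /\ L `<=` G.
have [F FP Ftot|G [PG Gmax]] := @Zorn_bigcup (V * R)%type P.
  move=> [p [G0 FG0 G0p]].
  have Fdom G q : F G -> G q -> dominated G /\ L `<=` G.
    by move=> FG Gq; apply: FP => //; exists q.
  split; last by move=> q Lq; exists G0 => //; exact: (Fdom _ _ FG0 G0p).2.
  split; last by move=> q [G FG Gq]; exact: (Fdom _ _ FG Gq).1.2.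
  move=> k q r [G FG Gq] [H FH Hr]; have [GH|HG] := Ftot _ _ FG FH.
    by exists H => //; apply: (Fdom _ _ FH Hr).1.1 => //; exact: GH.
  by exists G => //; apply: (Fdom _ _ FG Gq).1.1 => //; exact: HG.
have L0 : L (0, 0) by exists 0 => //; rewrite scale0r mul0r.
have G0 : G !=set0.
  apply/set0P/eqP => GE; apply: (Gmax L); last by split.
  by rewrite GE; split=> // /(_ _ L0).
have [domG LG] := PG G0.
have Gtot v : exists c, G (v, c).
  have [G' domG' [GG' [c G'c]]] := extend v domG G0; exists c.
  apply: contrapT => Gc; apply: (Gmax G'); last first.
    by split=> //; exact: subset_trans GG'.
  by split=> // G'G; apply: Gc; exact: G'G.
pose f v := projT1 (cid (Gtot v)).
have Gf v : G (v, f v) by rewrite /f; case: cid.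
have N0 : N 0 = 0 by rewrite /N normr0.
have Ginj v r s : G (v, r) -> G (v, s) -> r = s.
  suff le a b : G (v, a) -> G (v, b) -> a <= b.
    by move=> Gr Gs; apply/eqP; rewrite eq_le !le.
  move=> Ga Gb; have := domG.2 _ (domG.1 (-1) _ _ Gb Ga).
  by rewrite /= rmorphN rmorph1 scaleN1r mulN1r addNr N0 addrC subr_le0.
exists f; split=> [k x y|x|].
- by apply: Ginj (Gf _) _; exact: (domG.1 k _ _ (Gf x) (Gf y)).
- exact: (domG.2 _ (Gf x)).
- by apply: Ginj (Gf _) _; apply: LG; exists 1; rewrite // rmorph1 scale1r mul1r.
Qed.

Lemma norming_functional x0 :
  exists2 f : dual_space V, `|f| <= 1 & `|x0| <= `|f x0|.
Proof.
have [f [flin fN fx0]] := real_hahn_banach x0.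
have fD x y : f (x + y) = f x + f y.
  by have := flin 1 x y; rewrite rmorph1 scale1r mul1r.
have f0 : f 0 = 0 by apply: (addIr (f 0)); rewrite -fD !add0r.
have fZ (k : R) x : f (k%:C *: x) = k * f x.
  by have := flin k x 0; rewrite f0 !addr0.
(* The complex-linear functional whose real part is [f]. *)
pose h x : R[i] := f x +i* - f ('i *: x).
have hlin : linear (h : V -> R[i]^o).
  have hD x y : h (x + y) = h x + h y by rewrite /h scalerDr !fD opprD.
  have hR (k : R) x : h (k%:C *: x) = k%:C * h x.
    by rewrite /h scalerA mulrC -scalerA !fZ; simpc.
  have hi x : h ('i *: x) = 'i * h x.
    rewrite /h scalerA -expr2 sqr_i scaleN1r; simpc.
    have /eqP := fD x (- x); rewrite subrr f0 eq_sym addrC addr_eq0 => /eqP ->.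
    by rewrite opprK.
  move=> k x y; rewrite hD; congr (_ + _).
  rewrite [k in LHS]complexE scalerDl hD -scalerA hi !hR.
  by rewrite [in RHS](complexE k) mulrA -mulrDl.
have hle x : `|h x| <= 1 * `|x|.
  rewrite mul1r; have [->|hx0] := eqVneq (h x) 0; first by rewrite normr0.
  (* Rotating [x] by the unimodular [u] makes the value of [h] real, hence equal to [f (u *: x)],
     which is at most [N x]. *)
  pose u := `|h x| / h x.
  have huE : h (u *: x) = `|h x|.
    have := hlin u x 0; rewrite addr0 => ->.
    have -> : h 0 = 0 by rewrite /h scaler0 f0 oppr0.
    by rewrite addr0 /u -[_ *: _]/(_ * _) divfK.
  have nu : `|u| = 1 by rewrite normrM normfV normr_id divff ?normr_eq0.
  rewrite (ger0_real_complex (normr_ge0 (h x))) -huE.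
  rewrite norm_ReE lecR.
  apply: (le_trans (fN (u *: x))).
  by rewrite /N normrZ nu mul1r.
exists (Bop (bounded_linearP hlin (real1 _) hle)).
  exact: bop_norm_le.
rewrite norm_ReE -[complex.Re _]/(N x0) -fx0.
apply: le_trans (normc_ge_Re _); rewrite lecR; exact: ler_norm.
Qed.

End HahnBanach.

(** * Limits along ultrafilters *)

Section UltrafilterLimits.

Lemma ultra_fmap (T U : Type) (f : T -> U) (F : set_system T) :
  UltraFilter F -> UltraFilter (f @ F).
Proof.
move=> FU; split=> [|G GF sFG]; first exact: fmap_proper_filter.
apply/seteqP; split=> // B GB.
have [//|FnB] := in_ultra_setVsetC (f @^-1` B) FU.
have /sFG GnB : (f @ F) (~` B) by [].
by exfalso; apply: (@filter_not_empty _ G); rewrite -(setICr B); exact: filterI.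
Qed.

(* It suffices to control all ultrafilters: a failure of convergence survives
   in some ultrafilter finer than [F]. *)
Lemma cvg_ultra (T : Type) (U : topologicalType) (f : T -> U)
    (F : set_system T) (l : U) : ProperFilter F ->
  (forall G, UltraFilter G -> F `<=` G -> f @ G --> l) -> f @ F --> l.
Proof.
move=> FF Fl B lB; apply: contrapT => nFB.
have D (C : set T) : F C -> (C `&` ~` (f @^-1` B)) !=set0.
  move=> FC; apply: contrapT => CB; apply: nFB.
  apply: (@filterS _ F _ C (f @^-1` B)) FC => x Cx; apply: contrapT => nBx.
  by apply: CB; exists x.
have HF : ProperFilter (within (~` (f @^-1` B)) F).
  apply: Build_ProperFilter_ex => C FC.
  by have [x [xC nBx]] := D _ FC; exists x; exact: xC.
have [G [GU sG]] := ultraFilterLemma HF.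
have FG : F `<=` G by apply: subset_trans sG; exact: cvg_within.
have GB : G (f @^-1` B) by exact: (Fl G GU FG).
have GnB : G (~` (f @^-1` B)) by apply: sG; exact: withinT.
by apply: (@filter_not_empty _ G); rewrite -(setICr (f @^-1` B)); exact: filterI.
Qed.

Context {R : realType} {I : Type}.
Implicit Types F : set_system I.

Lemma ultra_real_cvg F (h : I -> R) (M : R) : UltraFilter F ->
  (forall i, `|h i| <= M) -> exists z : R, h @ F --> z.
Proof.
move=> FU hM; have := @segment_compact R (- M) M.
rewrite compact_ultra => /(_ _ (ultra_fmap h FU))[|z [_ Fz]]; last by exists z.
by apply: (@filterE I F) => i; rewrite /= in_itv/= -ler_norml.
Qed.

Lemma ultra_complex_cvg F (h : I -> R[i]^o) (M : R) : UltraFilter F ->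
  (forall i, `|h i| <= M%:C) -> exists z : R[i]^o, h @ F --> z.
Proof.
move=> FU hM.
have [x Fx] : exists x : R, (fun i => complex.Re (h i)) @ F --> x.
  apply: (@ultra_real_cvg _ _ M) => i.
  by rewrite -lecR (le_trans (normc_ge_Re _)).
have [y Fy] : exists y : R, (fun i => complex.Im (h i)) @ F --> y.
  apply: (@ultra_real_cvg _ _ M) => i.
  by rewrite -lecR (le_trans (normc_ge_Im _)).
exists (x +i* y); apply/cvgrPdist_lt => e e0.
have eE := ger0_real_complex (ltW e0).
have e2 : 0 < complex.Re e / 2.
  by rewrite divr_gt0// -ltcR -eE.
near=> i.
have hx : `|x - complex.Re (h i)| < complex.Re e / 2.
  by near: i; move/cvgrPdist_lt : Fx; exact.
have hy : `|y - complex.Im (h i)| < complex.Re e / 2.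
  by near: i; move/cvgrPdist_lt : Fy; exact.
apply: (le_lt_trans (normc_le_ReIm _)).
rewrite eE ltcR (splitr (complex.Re e)); apply: ltrD.
  by move: hx; case: (h i).
by move: hy; case: (h i).
Unshelve. all: by end_near. Qed.

Lemma cvg_norm_le (W : normedModType R[i]) F (h : I -> W) (z : W) (M : R[i]) :
  ProperFilter F -> 0 <= M ->
  (\forall i \near F, `|h i| <= M) -> h @ F --> z -> `|z| <= M.
Proof.
move=> FF M0 hM hz; rewrite norm_ReE (ger0_real_complex M0) lecR.
apply/ler_addgt0Pr => e e0.
have e0' : (0 : R[i]) < e%:C by rewrite -(rmorph0 (real_complex R)) ltcR.
have /filter_ex[i [hi1 hi2]] :
    \forall i \near F, `|z - h i| < e%:C /\ `|h i| <= M.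
  by apply: filterI => //; move/cvgrPdist_lt : hz; exact.
rewrite -lecR rmorphD/= -norm_ReE -ger0_real_complex//.
rewrite -[z](subrK (h i)) (le_trans (ler_normD _ _))// addrC lerD//.
exact: ltW.
Qed.

(** The Banach-Alaoglu theorem in ultrafilter form: the values at each [x] stay in a bounded set and
    so converge, and the pointwise limit inherits linearity and the bound. *)
Lemma ultra_dual_cvg (V : normedModType R[i]) F (f : I -> dual_space V) (M : R) :
  UltraFilter F -> (forall i, `|f i| <= M%:C) ->
  exists g : dual_space V, forall x,
    (fun i => f i x : R[i]^o) @ F --> (g x : R[i]^o).
Proof.
move=> FU fM.
have [i0 _] : exists i, [set: I] i := filter_ex (filterT : F setT).
have MC0 : 0 <= M%:C := le_trans (normr_ge0 _) (fM i0).
have fx i x : `|f i x| <= M%:C * `|x|.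
  by rewrite (le_trans (le_bop_norm _ _))// ler_wpM2r.
have lim x : exists z : R[i]^o, (fun i => f i x : R[i]^o) @ F --> z.
  apply: (@ultra_complex_cvg _ _ (complex.Re (M%:C * `|x|))) => // i.
  by rewrite -ger0_real_complex// mulr_ge0.
pose g x := projT1 (cid (lim x)).
have gP x : (fun i => f i x : R[i]^o) @ F --> (g x : R[i]^o).
  by rewrite /g; case: cid.
have glin : linear g.
  move=> k x y; apply: norm_cvg_unique (gP _) _.
  have -> : (fun i => f i (k *: x + y) : R[i]^o) =
      (fun i => k *: (f i x : R[i]^o) + f i y).
    by apply/funext => i; rewrite linearP.
  by apply: cvgD => //; exact: cvgZl_tmp.
have gM x : `|g x| <= M%:C * `|x|.
  apply: cvg_norm_le (gP x); first by rewrite mulr_ge0.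
  exact: filterE.
by exists (Bop (bounded_linearP glin (ger0_real MC0) gM)).
Qed.

End UltrafilterLimits.

(** * The module actions and the first Arens product *)

Section ArensProduct.
Context {R : realType} {A : banachAlgType R}.
Implicit Types (S : dual_space A) (a b : A) (Phi Psi : dual_space (luc A)).

Lemma actAD (S T : dual_space A) a : actA (S + T) a = actA S a + actA T a.
Proof. exact: bop_eqP. Qed.

Lemma actAZ (k : R[i]) S a : actA (k *: S) a = k *: actA S a.
Proof. exact: bop_eqP. Qed.

Lemma actAB S a b : actA S (a - b) = actA S a - actA S b.
Proof.
apply: bop_eqP => c; rewrite -[RHS]/(S (amul a c) - S (amul b c)).
by rewrite /= -scaleN1r amulDl amulZl scaleN1r linearB.
Qed.

Lemma actA_mul S a b : actA (actA S a) b = actA S (amul a b).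
Proof. by apply: bop_eqP => c; rewrite /= amulA. Qed.

Lemma luc_eval_linear (k : R[i]) a b :
  luc_eval (k *: a + b) = k *: luc_eval a + luc_eval b.
Proof. by apply: bop_eqP => S; rewrite /= linearP. Qed.

Lemma luc_eval_mul a b : arens (luc_eval a) (luc_eval b) = luc_eval (amul a b).
Proof. exact: bop_eqP. Qed.

Lemma luc_eval_norm a : `|luc_eval a| <= `|a|.
Proof.
by apply: bop_norm_le => // S; rewrite mulrC; exact: (le_bop_norm (luc_val S) a).
Qed.

Lemma arensA : associative (@arens R A).
Proof.
move=> Phi Psi Theta; apply: bop_eqP => S; congr (Phi _).
by apply/val_inj/bop_eqP => a; congr (Psi _); apply/val_inj; rewrite /= actD_actA.
Qed.

Lemma arens_lucA Phi Psi S a :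
  arens Phi Psi (lucA S a) = actD Phi (actD Psi S) a.
Proof. by congr (Phi _); apply/val_inj; rewrite /= actD_actA. Qed.

Lemma arens_norm Phi Psi : `|arens Phi Psi| <= `|Phi| * `|Psi|.
Proof.
apply: bop_norm_le; first by rewrite mulr_ge0.
move=> S; rewrite -mulrA (le_trans (le_bop_norm Phi (actL Psi S)))//.
by rewrite ler_wpM2l//; exact: actD_norm.
Qed.

Lemma arens_linearr Phi (k : R[i]) Psi Psi' :
  arens Phi (k *: Psi + Psi') = k *: arens Phi Psi + arens Phi Psi'.
Proof.
apply: bop_eqP => S.
have -> : arens Phi (k *: Psi + Psi') S =
    Phi (k *: actL Psi S + actL Psi' S).
  by congr (Phi _); apply/val_inj/bop_eqP.
by rewrite linearP.
Qed.

(** This is the associativity [(a b) Psi = a (b Psi)]. It is stated under [luc_eval], whose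
    injectivity will come from the approximate identity. *)
Lemma rmult_mulP Psi (T : bop A A) : is_rmult_of Psi T ->
  forall a b, luc_eval (T (amul a b)) = luc_eval (amul a (T b)).
Proof. by move=> PT a b; rewrite -PT -luc_eval_mul -arensA PT luc_eval_mul. Qed.

Lemma is_rmult_of_linear (k : R[i]) Phi Psi (P Q : bop A A) :
  is_rmult_of Phi P -> is_rmult_of Psi Q ->
  is_rmult_of (k *: Phi + Psi) (k *: P + Q).
Proof.
by move=> hP hQ a; rewrite arens_linearr hP hQ -luc_eval_linear.
Qed.

Lemma is_rmult_ofB Phi Psi (P Q : bop A A) :
  is_rmult_of Phi P -> is_rmult_of Psi Q -> is_rmult_of (Phi - Psi) (P - Q).
Proof.
move=> hP hQ; have subE (V : lmodType R[i]) (x y : V) : x - y = -1 *: y + x.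
  by rewrite scaleN1r addrC.
by rewrite (subE _ Phi) (subE _ P); exact: is_rmult_of_linear.
Qed.

Lemma is_rmult_of_arens Phi Psi (P Q : bop A A) :
  is_rmult_of Phi P -> is_rmult_of Psi Q ->
  is_rmult_of (arens Phi Psi) (rmult_mul P Q).
Proof. by move=> hP hQ a; rewrite arensA hP hQ. Qed.

Lemma is_rmult_of_IA Psi (T : bop A A) : is_rmult_of Psi T -> @IA R A Psi.
Proof. by move=> PT a; exists (T a); exact: PT. Qed.

(** * Right multipliers in the presence of a bounded approximate identity *)

Section BoundedApproximateIdentity.
Context {I : Type} {le : I -> I -> Prop} {e : I -> A}.
Hypothesis bai : bounded_approximate_identity le e.

#[local] Instance tails_bai : ProperFilter (tails le).
Proof. by apply: tails_proper; case: bai. Qed.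

(** For a functional [f] norming [a], [f a] is the limit of [f (e_i a)], the value of [luc_eval a]
    at [f . e_i], and [f . e_i] has norm at most [M]. For [M = 1] the embedding of [A] is
    isometric. *)
Lemma bai_norm_le (M : R) a : (forall i, `|e i| <= M%:C) ->
  `|a| <= M%:C * `|luc_eval a|.
Proof.
move=> eM; have [_ _ ea _] := bai; have [f f1 fa] := norming_functional a.
have [i0 _] : exists i, [set: I] i := filter_ex (filterT : tails le setT).
have M0 : 0 <= M%:C := le_trans (normr_ge0 _) (eM i0).
apply: (le_trans fa); apply: (@cvg_norm_le _ _ R[i]^o (tails le)
  (fun i => f (amul (e i) a))); first by rewrite mulr_ge0.
  apply: filterE => i.
  rewrite -[f _]/(luc_eval a (lucA f (e i))) (le_trans (le_bop_norm _ _))//.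
  rewrite mulrC ler_wpM2r// (le_trans (actA_norm _ _))//.
  by rewrite -[leRHS]mul1r ler_pM.
by apply: continuous_cvg; [exact: bop_continuous|exact: ea].
Qed.

Lemma luc_eval_inj : injective (@luc_eval R A).
Proof.
have [_ [M eM] _ _] := bai; move=> a b ab.
apply/eqP; rewrite -subr_eq0 -normr_eq0 eq_le normr_ge0 andbT.
rewrite (le_trans (bai_norm_le _ eM))// -scaleN1r addrC luc_eval_linear ab.
by rewrite scaleN1r addNr normr0 mulr0.
Qed.

(** On a generator, [(S' . a) . e_i = S' . (a e_i)] tends to [S' . a]. The property passes to the
    span by linearity, and to its closure because the [e_i] are bounded. *)
Lemma lucA_bai_cvg (S : luc A) : lucA S (e i) @[i --> tails le] --> S.
Proof.
have [_ [M eM] _ ae] := bai.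
have [i0 _] : exists i, [set: I] i := filter_ex (filterT : tails le setT).
have M0 : 0 <= M%:C := le_trans (normr_ge0 _) (eM i0).
pose D : set (dual_space A) := [set T | actA T (e i) @[i --> tails le] --> T].
have Dspan T : span_set [set actA S a | S in setT & a in setT] T -> D T.
  move=> [n [c [g [Gg ->]]]]; apply: (big_ind D).
  - rewrite /D/=; apply: cvg_near_cst; apply: filterE => i.
    exact: bop_eqP.
  - move=> T1 T2 D1 D2; rewrite /D/=.
    under eq_fun do rewrite actAD.
    exact: cvgD.
  - move=> j _; rewrite /D/=; under eq_fun do rewrite actAZ.
    apply: cvgZl_tmp; have [S' _ [a _ <-]] := Gg j.
    apply/cvgrPdist_lt => eps eps0.
    have S1 : 0 < `|S'| + 1 by rewrite ltr_wpDl.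
    have : \forall i \near tails le, `|a - amul a (e i)| < eps / (`|S'| + 1).
      by move/cvgrPdist_lt : (ae a); apply; rewrite divr_gt0.
    apply: filterS => i; rewrite ltr_pdivlMr// mulrC => ai.
    rewrite actA_mul -actAB (le_lt_trans (actA_norm _ _))//.
    by rewrite (le_lt_trans _ ai)// ler_wpM2r// lerDl.
apply/cvgrPdist_lt => eps eps0.
(* The three summands [1], [M] and [1] pay for [S - T], [(S - T) . e_i] and [T - T . e_i]. *)
have M1 : 0 < 1 + M%:C + 1 by rewrite ltr_wpDl// addr_ge0.
have [T GT ST] := (LUC_approxP S).1 (set_mem (lucP S)) (eps / (1 + M%:C + 1))
  ltac:(by rewrite divr_gt0).
have : \forall i \near tails le, `|T - actA T (e i)| < eps / (1 + M%:C + 1).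
  by move/cvgrPdist_lt : (Dspan T GT); apply; rewrite divr_gt0.
apply: filterS => i Ti; rewrite -[`|_|]/(`|luc_val S - actA S (e i)|).
have -> : luc_val S - actA S (e i) =
    (luc_val S - T) - actA (luc_val S - T) (e i) + (T - actA T (e i)).
  have -> : actA (luc_val S - T) (e i) = actA S (e i) - actA T (e i).
    by rewrite actAD -scaleN1r actAZ scaleN1r.
  by rewrite opprB [RHS]addrC addrACA [T + _]addrC subrK addKr.
have -> : eps = eps / (1 + M%:C + 1) * (1 + M%:C) + eps / (1 + M%:C + 1).
  by rewrite -[X in _ + X]mulr1 -mulrDr divfK// gt_eqF.
rewrite (le_lt_trans (ler_normD _ _))// ler_ltD//.
rewrite (le_trans (ler_normB _ _))// mulrDr mulr1 lerD//; first exact: ltW.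
by rewrite (le_trans (actA_norm _ _))// ler_pM// ltW.
Qed.

(** Injectivity of [luc_eval] makes the chosen map [t] linear, and the lower bound on [luc_eval]
    makes it bounded by [M] times the norm of [Psi]. *)
Lemma IA_rmult Psi : @IA R A Psi -> exists T : bop A A, is_rmult_of Psi T.
Proof.
move=> PI; have [_ [M eM] _ _] := bai.
have [i0 _] : exists i, [set: I] i := filter_ex (filterT : tails le setT).
have M0 : 0 <= M%:C := le_trans (normr_ge0 _) (eM i0).
pose t a := projT1 (cid (PI a)).
have tP a : arens (luc_eval a) Psi = luc_eval (t a) by rewrite /t; case: cid.
have tlin : linear t.
  move=> k a b; apply: luc_eval_inj.
  by rewrite -tP !luc_eval_linear -!tP; exact: bop_eqP.
have tM a : `|t a| <= (M%:C * `|Psi|) * `|a|.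
  rewrite (le_trans (bai_norm_le _ eM))// -mulrA ler_wpM2l// -tP.
  by rewrite (le_trans (arens_norm _ _))// mulrC ler_wpM2l// luc_eval_norm.
by exists (Bop (bounded_linearP tlin (ger0_real (mulr_ge0 M0 (normr_ge0 _))) tM)).
Qed.

Lemma is_rmult_of_right_multiplier Psi (T : bop A A) :
  is_rmult_of Psi T -> right_multipliers T.
Proof. by move=> PT a b; apply: luc_eval_inj; exact: rmult_mulP PT _ _. Qed.

Lemma is_rmult_of_inj Psi (P Q : bop A A) :
  is_rmult_of Psi P -> is_rmult_of Psi Q -> P = Q.
Proof.
by move=> hP hQ; apply: bop_eqP => a; apply: luc_eval_inj; rewrite -hP -hQ.
Qed.

(* The hypothesis only gives the values of [a Psi] on [LUC A]; the approximate
   identity extends the identity to all functionals on [A]. *)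
Lemma rmult_actD Psi (T : bop A A) S a :
  is_rmult_of Psi T -> actD Psi S a = S (T a).
Proof.
move=> PT; have [_ _ _ ae] := bai.
have l : actD Psi S (amul a (e i)) @[i --> tails le] --> (actD Psi S a : R[i]^o).
  by apply: continuous_cvg; [exact: bop_continuous|exact: ae].
(* At [a e_i] both sides are the value of [e_i Psi] at [S . a], which lies in [LUC A]. *)
have E i : actD Psi S (amul a (e i)) = S (T (amul a (e i))).
  rewrite (is_rmult_of_right_multiplier PT).
  rewrite -[RHS]/(luc_eval (T (e i)) (lucA S a)) -PT /=; congr (Psi _).
  by apply/val_inj; rewrite /= actA_mul.
have r : actD Psi S (amul a (e i)) @[i --> tails le] --> (S (T a) : R[i]^o).
  under eq_fun do rewrite E; apply: continuous_cvg; first exact: bop_continuous.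
  by apply: continuous_cvg; [exact: bop_continuous|exact: ae].
exact: norm_cvg_unique l r.
Qed.

(** One inequality holds because [T a] has the norm of [a Psi]. For the other, [Psi S] is the limit
    of [Psi (S . e_i)], the value of [T e_i] at [S], and [e_i] lies in the unit ball. *)
Lemma rmult_norm Psi (T : bop A A) : (forall i, `|e i| <= 1) ->
  is_rmult_of Psi T -> `|T| = `|Psi|.
Proof.
move=> e1 PT; have e1' i : `|e i| <= (1 : R)%:C by rewrite rmorph1.
apply/eqP; rewrite eq_le; apply/andP; split.
  apply: bop_norm_le => // a; rewrite (le_trans (bai_norm_le _ e1'))//.
  rewrite rmorph1 mul1r -PT mulrC (le_trans (arens_norm _ _))// ler_wpM2r//.
  exact: luc_eval_norm.
apply: bop_norm_le => // S.
apply: (@cvg_norm_le _ _ R[i]^o (tails le) (fun i => Psi (lucA S (e i)))).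
- by rewrite mulr_ge0.
- apply: filterE => i.
  rewrite -[Psi _]/(arens (luc_eval (e i)) Psi S) PT.
  rewrite (le_trans (le_bop_norm _ _))// ler_wpM2r//.
  rewrite (le_trans (luc_eval_norm _))// (le_trans (le_bop_norm _ _))//.
  by rewrite ler_piMr.
by apply: continuous_cvg; [exact: bop_continuous|exact: lucA_bai_cvg].
Qed.

(** Take for [Psi] the weak* limit of [T e_i] along an ultrafilter finer than the tails: the value
    of [a Psi] at [S] is the limit of [S (a (T e_i)) = S (T (a e_i))], which is [S (T a)]. *)
Lemma right_multiplier_rmult (T : bop A A) : right_multipliers T ->
  exists Psi, is_rmult_of Psi T.
Proof.
move=> Tmul; have [_ [M eM] _ ae] := bai.
have [U [UU tU]] := ultraFilterLemma tails_bai.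
have [i0 _] : exists i, [set: I] i := filter_ex (filterT : tails le setT).
have M0 : 0 <= M%:C := le_trans (normr_ge0 _) (eM i0).
have bnd i : `|luc_eval (T (e i))| <= (complex.Re (`|T| * M%:C))%:C.
  rewrite -ger0_real_complex ?mulr_ge0//.
  rewrite (le_trans (luc_eval_norm _))// (le_trans (le_bop_norm _ _))//.
  by rewrite ler_wpM2l.
have [Psi PsiP] := ultra_dual_cvg UU bnd; exists Psi => a.
apply: bop_eqP => S; apply: norm_cvg_unique (PsiP (lucA S a)) _.
have -> : (fun i => luc_eval (T (e i)) (lucA S a) : R[i]^o) =
    (fun i => S (T (amul a (e i))) : R[i]^o).
  by apply/funext => i; rewrite Tmul.
apply: (@cvg_trans _ ((fun i => S (T (amul a (e i))) : R[i]^o) @ tails le)).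
  exact: cvg_app.
apply: continuous_cvg; first exact: bop_continuous.
by apply: continuous_cvg; [exact: bop_continuous|exact: ae].
Qed.

(* Left multiplication by [Psi] on [LUC A]^* is the adjoint of an operator of
   [LUC A], which sends [S . a] to [S . (T a)]. *)
Lemma rmult_predual Psi (T : bop A A) (S : luc A) : is_rmult_of Psi T ->
  exists S' : luc A, forall Phi, arens Psi Phi S = Phi S'.
Proof.
(* The case [Phi = luc_eval b] forces this value of [S'] at [b]. *)
move=> PT; pose s b := arens Psi (luc_eval b) S.
have slin : linear (s : A -> R[i]^o).
  by move=> k a b; rewrite /s luc_eval_linear arens_linearr.
have sM b : `|s b| <= (`|Psi| * `|S|) * `|b|.
  rewrite (le_trans (le_bop_norm _ _))// mulrAC ler_wpM2r//.
  rewrite (le_trans (arens_norm _ _))// ler_wpM2l//.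
  exact: luc_eval_norm.
pose s' : dual_space A :=
  Bop (bounded_linearP slin (ger0_real (mulr_ge0 (normr_ge0 _) (normr_ge0 _))) sM).
have arens_lucA_rmult Phi U a : arens Psi Phi (lucA U a) = Phi (lucA U (T a)).
  by rewrite arens_lucA (rmult_actD _ _ PT).
(* The difference at [b] is the value of [Psi b] at [S - S . e_i], small uniformly over the unit
   ball. Hence [s'] is a norm limit in the closed set [LUC A]. *)
have cvgs : actA S (T (e i)) @[i --> tails le] --> s'.
  apply/cvgrPdist_lt => eps eps0.
  have P1 : 0 < `|Psi| + 1 by rewrite ltr_wpDl.
  have : \forall i \near tails le, `|S - lucA S (e i)| < eps / (`|Psi| + 1).
    by move/cvgrPdist_lt : (@lucA_bai_cvg S); apply; rewrite divr_gt0.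
  apply: filterS => i; rewrite ltr_pdivlMr// mulrC; apply: le_lt_trans.
  apply: bop_norm_le; first by rewrite mulr_ge0// ltW.
  move=> b; have -> : (s' - actA S (T (e i))) b =
      arens Psi (luc_eval b) (S - lucA S (e i)).
    rewrite linearB/= -[X in _ = _ - X]/(arens Psi (luc_eval b) (lucA S (e i))).
    by rewrite arens_lucA_rmult.
  rewrite (le_trans (le_bop_norm _ _))// mulrAC ler_wpM2r//.
  rewrite (le_trans (arens_norm _ _))// ler_pM// ?lerDl//.
  exact: luc_eval_norm.
have LUCs' : s' \in @LUC_pred R A.
  apply/mem_set.
  apply: (@closed_cvg _ _ (tails le) _ (fun i => actA S (T (e i))) (@LUC R A)).
  - exact: closed_closure.
  - by apply: filterE => i; exact: set_mem (actA_LUC _ _).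
  - exact: cvgs.
exists (Luc LUCs') => Phi.
have l : arens Psi Phi (lucA S (e i)) @[i --> tails le] -->
    (arens Psi Phi S : R[i]^o).
  by apply: continuous_cvg; [exact: bop_continuous|exact: lucA_bai_cvg].
have r : arens Psi Phi (lucA S (e i)) @[i --> tails le] -->
    (Phi (Luc LUCs') : R[i]^o).
  under eq_fun do rewrite arens_lucA_rmult.
  apply: continuous_cvg; first exact: bop_continuous.
  by apply/cvgrPdist_lt; move/cvgrPdist_lt : cvgs; exact.
exact: norm_cvg_unique l r.
Qed.

(** Testing [arens Psi] at [S] amounts to evaluating at a fixed [S'], a weak* continuous operation
    on the whole dual, and continuity restricts to [Sg]. *)
Lemma IA_T1Z (Sg : set (dual_space (luc A))) Psi :
  Sg Psi -> @IA R A Psi -> T1Z Sg Psi.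
Proof.
move=> SPsi /IA_rmult[T PT]; split=> //.
apply: continuous_subspaceT => Phi.
have FF : Filter (nbhs (Phi : weakstar (luc A))) by exact: nbhs_filter.
apply: (weakstar_cvgP (arens Psi Phi) (fmap_filter (arens Psi) FF)).2 => S.
have [S' PS'] := rmult_predual S PT.
rewrite PS'.
have PE : (fun Theta : dual_space (luc A) => arens Psi Theta S : R[i]^o) =
    (fun Theta => Theta S' : R[i]^o) by apply/funext.
by have := (weakstar_cvgP Phi FF).1 (@cvg_id _ _) S'; rewrite -PE.
Qed.

End BoundedApproximateIdentity.
End ArensProduct.

(** * Identification of the topological centre *)

Section TopologicalCentre.
Context {R : realType} {A : banachAlgType R}.
Implicit Types (Phi Psi : dual_space (luc A)) (Sg : set (dual_space (luc A))).

Lemma card_le_injection (I eta : Type) : [set: I] #<= [set: eta] ->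
  exists g : I -> eta, injective g.
Proof.
move=> /card_leP[f]; exists (fun i => \val (f (to_setT i))) => i j.
move=> /val_inj fij; have := 'inj_f (in_setT _) (in_setT _) fij.
by move=> /(congr1 val).
Qed.

Lemma sum_bopE (V W : normedModType R[i]) (J : Type) (r : seq J)
    (f : J -> bop V W) x : (\sum_(j <- r) f j) x = \sum_(j <- r) f j x.
Proof.
elim: r => [|j r IH]; first by rewrite !big_nil.
by rewrite !big_cons bopDE IH.
Qed.

(** Continuity of [arens Psi] is only relative to [Sg]. Weak* closedness puts the limit [Phi] in
    [Sg], and the family stays in [Sg], so relative continuity applies. *)
Lemma T1Z_continuous Sg Psi (I : Type) (U : set_system I)
    (f : I -> dual_space (luc A)) Phi :
  weakstar_closed Sg -> T1Z Sg Psi -> ProperFilter U -> (forall i, Sg (f i)) ->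
  (forall S, (fun i => f i S : R[i]^o) @ U --> (Phi S : R[i]^o)) ->
  forall S, (fun i => arens Psi (f i) S : R[i]^o) @ U -->
    (arens Psi Phi S : R[i]^o).
Proof.
move=> clSg [_ /subspace_continuousP Pc] UU Sf fPhi.
have fw : f @ U --> (Phi : weakstar (luc A)).
  exact: (weakstar_cvgP Phi (fmap_filter f _)).2.
have SPhi : Sg Phi.
  apply: (@closed_cvg _ (weakstar (luc A)) U _ f Sg) fw => //.
  exact: filterE.
have fwSg : f @ U --> within Sg (nbhs (Phi : weakstar (luc A))).
  move=> B /fw; apply: (@filterS _ U _) => i /=; exact.
have Pw : arens Psi @ (f @ U) --> (arens Psi Phi : weakstar (luc A)).
  by move=> B /(Pc _ SPhi); exact: fwSg.
exact: (weakstar_cvgP (arens Psi Phi) (fmap_filter (arens Psi) _)).1 Pw.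
Qed.

(* The functional [S |-> Psi (S . a)] is tested on a weak* null net: factor the
   net through bounded nets of [Sg], which converge weak* along ultrafilters,
   and let the centrality of [Psi] carry the limit through the product. *)
Lemma T1Z_IA (eta : Type) (m : nat) (X : 'I_m -> set (dual_space (luc A))) Sg Psi :
  eta_Mazur A eta -> eta_factorization eta X -> weakstar_closed Sg ->
  \bigcup_k X k `<=` Sg -> T1Z Sg Psi -> @IA R A Psi.
Proof.
move=> mazur fact clSg XSg PZ a.
have Flin : linear (fun S : dual_space A => actD Psi S a : R[i]^o).
  by move=> k S T; rewrite linearP.
have FM (S : dual_space A) : `|actD Psi S a : R[i]^o| <= (`|Psi| * `|a|) * `|S|.
  rewrite mulrAC (le_trans (le_bop_norm _ _))// ler_wpM2r//.
  exact: actD_norm.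
pose F : dual_space (dual_space A) :=
  Bop (bounded_linearP Flin (ger0_real (mulr_ge0 (normr_ge0 _) (normr_ge0 _))) FM).
(* A [b] with [F S = S b] for all [S] gives [a Psi = b] on restriction to [LUC A]. *)
have [|b Fb] := mazur F; last by exists b; apply: bop_eqP => S; exact: (Fb S).
move=> I le S dirI _ /card_le_injection[g ginj] S1 S0.
(* Factorization concerns families indexed by [eta]: the net is carried along the injection [g] and
   is set to 0 off its image. *)
pose S' x := if pselect (exists i, g i = x) is left H then S (projT1 (cid H)) else 0.
have S'g i : S' (g i) = S i.
  rewrite /S'; case: pselect => [H|[]]; last by exists i.
  by congr S; apply: ginj; case: cid.
have S'1 : exists M : R, forall x, `|S' x| <= M%:C.
  exists 1 => x; rewrite rmorph1 /S'; case: pselect => [H|_]; first exact: S1.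
  by rewrite normr0.
have [Ps [T [PX [M PM] S'E]]] := fact S' S'1.
have tF := tails_proper dirI.
apply: cvg_ultra => U UU tU.
have lim k : exists Phi : dual_space (luc A), forall V,
    (fun i => Ps (g i) k V : R[i]^o) @ U --> (Phi V : R[i]^o).
  by apply: (ultra_dual_cvg UU) => i; exact: PM.
have [Phi PhiP] := choice lim.
have sumE (Th : 'I_m -> dual_space (luc A)) :
    F (\sum_(k < m) actD (Th k) (T k)) =
    \sum_(k < m) arens Psi (Th k) (lucA (T k) a).
  rewrite -[LHS]/(actD Psi _ a) linear_sum sum_bopE; apply: eq_bigr => k _.
  by rewrite arens_lucA.
have sum_cvg (f : 'I_m -> I -> R[i]^o) (l : 'I_m -> R[i]^o) :
    (forall k, f k @ U --> l k) ->
    (fun i => \sum_(k < m) f k i) @ U --> \sum_(k < m) l k.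
  by move=> fl; apply: cvg_big => [|k _]; [exact: add_continuous|exact: fl].
(* The [T k] do not vary with [i], so at each [c] this sum is the limit of [S i c], which is 0 as
   the net is weak* null. *)
have Phi0 : \sum_(k < m) actD (Phi k) (T k) = 0.
  apply: bop_eqP => c; rewrite sum_bopE.
  have l := sum_cvg _ _ (fun k => PhiP k (lucA (T k) c)).
  have r : (fun i => S i c : R[i]^o) @ U --> (0 : R[i]^o).
    apply: cvg_trans ((weakstar_cvgP 0 (fmap_filter S _)).1 S0 c).
    exact: cvg_app.
  apply: norm_cvg_unique l _; move: r.
  by under eq_fun do rewrite -S'g S'E sum_bopE.
(* With the limit 0 written as the image under [F] of the vanishing sum, convergence can be checked
   separately for each [k]. *)
have -> : (0 : R[i]^o) = \sum_(k < m) arens Psi (Phi k) (lucA (T k) a).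
  by rewrite -sumE Phi0 linear0.
have -> : (fun i => F (S i) : R[i]^o) =
    (fun i => \sum_(k < m) (arens Psi (Ps (g i) k) (lucA (T k) a) : R[i]^o)).
  by apply/funext => i; rewrite -S'g S'E sumE.
apply: sum_cvg => k; apply: (T1Z_continuous clSg PZ _ _ (PhiP k)) => i.
by apply: XSg; exists k => //; exact: PX.
Qed.

Context {I : Type} {le : I -> I -> Prop} {e : I -> A}.

(** The map is [Phi |-> R_Phi]. Uniqueness of the multiplier turns closure properties of
    [is_rmult_of] into identities for [theta]; [rmult_norm] on differences gives the isometry, and
    with it injectivity. *)
Lemma IA_isometry Sg : bounded_approximate_identity le e ->
  (forall i, `|e i| <= 1) -> subsemigroup Sg ->
  exists theta : dual_space (luc A) -> bop A A,
    (forall Phi, @IA R A Phi -> is_rmult_of Phi (theta Phi)) /\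
    isometric_isomorphism (@arens R A) (@rmult_mul R A)
      (Sg `&` @IA R A) (capMr Sg) theta.
Proof.
move=> bai e1 semi.
(* The default value 0 is taken exactly where no multiplier represents [Phi], or where that
   multiplier is 0. *)
pose theta Phi : bop A A := xget 0 [set T | is_rmult_of Phi T].
have thetaP Phi : @IA R A Phi -> is_rmult_of Phi (theta Phi).
  by move=> /(IA_rmult bai) exT; exact: (xgetPex 0 exT).
have thetaE Phi T : is_rmult_of Phi T -> theta Phi = T.
  move=> PT; have IPhi := is_rmult_of_IA PT.
  exact: (is_rmult_of_inj bai (thetaP _ IPhi) PT).
have thetaB Phi Psi : @IA R A Phi -> @IA R A Psi ->
    `|theta Phi - theta Psi| = `|Phi - Psi|.
  move=> IPhi IPsi; apply: (rmult_norm bai e1).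
  exact: is_rmult_ofB (thetaP _ IPhi) (thetaP _ IPsi).
exists theta; split=> //; split.
- split.
  + move=> Phi [SPhi IPhi]; split; last by exists Phi => //; exact: thetaP.
    exact: (is_rmult_of_right_multiplier bai (thetaP _ IPhi)).
  + move=> Phi Psi /set_mem[_ IPhi] /set_mem[_ IPsi] eqt.
    apply/eqP; rewrite -subr_eq0 -normr_eq0 -thetaB// eqt subrr.
    by rewrite normr0.
  + by move=> T [_ [Phi SI PT]]; exists Phi => //; exact: thetaE.
- move=> Phi Psi [SPhi IPhi] [SPsi IPsi].
  have PT := is_rmult_of_arens (thetaP _ IPhi) (thetaP _ IPsi).
  by split; [split; [exact: semi|exact: is_rmult_of_IA PT]|exact: thetaE].
- move=> k Phi Psi [_ IPhi] [_ IPsi] _.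
  by apply: thetaE; apply: is_rmult_of_linear; exact: thetaP.
- by move=> Phi Psi [_ IPhi] [_ IPsi]; exact: thetaB.
Qed.

End TopologicalCentre.

Theorem theorem3p8 (R : realType) (A : banachAlgType R)
    (I : Type) (le : I -> I -> Prop) (e : I -> A)
    (eta : Type) (m : nat) (X : 'I_m -> set (dual_space (luc A))) :
  bounded_approximate_identity le e ->
  infinite_set [set: eta] ->
  (0 < m)%N ->
  (forall k, [set: eta] #<= X k) ->
  eta_Mazur A eta ->
  eta_factorization eta X ->
  [/\ forall Sg : set (dual_space (luc A)),
        weakstar_closed Sg -> subsemigroup Sg -> \bigcup_k X k `<=` Sg ->
        T1Z Sg = Sg `&` @IA R A,
      (forall i, `|e i| <= 1) ->
      forall Sg : set (dual_space (luc A)),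
        weakstar_closed Sg -> subsemigroup Sg -> \bigcup_k X k `<=` Sg ->
        exists theta : dual_space (luc A) -> bop A A,
          (forall Phi, T1Z Sg Phi -> is_rmult_of Phi (theta Phi)) /\
          isometric_isomorphism (@arens R A) (@rmult_mul R A)
            (T1Z Sg) (capMr Sg) theta
    & (forall i, `|e i| <= 1) ->
      exists theta : dual_space (luc A) -> bop A A,
        [/\ forall Phi, T1Z [set: dual_space (luc A)] Phi ->
              is_rmult_of Phi (theta Phi),
            linear_subspace (T1Z [set: dual_space (luc A)]),
            linear_subspace (@right_multipliers R A)
          & isometric_isomorphism (@arens R A) (@rmult_mul R A)
              (T1Z [set: dual_space (luc A)]) (@right_multipliers R A) theta]].
Proof.
move=> bai _ _ _ mazur fact.
(* This equality is (1), and it reduces (2) and (3) to [IA_isometry]. *)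
have T1ZE (Sg : set (dual_space (luc A))) : weakstar_closed Sg ->
    \bigcup_k X k `<=` Sg -> T1Z Sg = Sg `&` @IA R A.
  move=> clSg XSg; apply/seteqP; split=> Psi.
    by move=> PZ; split; [case: PZ|exact: T1Z_IA mazur fact clSg XSg PZ].
  by move=> [SPsi IPsi]; exact: (IA_T1Z bai).
split=> [Sg clSg _ XSg|e1 Sg clSg semi XSg|e1]; first exact: T1ZE.
  rewrite (T1ZE _ clSg XSg).
  have [theta [thetaP iso]] := IA_isometry bai e1 semi.
  by exists theta; split=> // Phi [_]; exact: thetaP.
rewrite (T1ZE [set: dual_space (luc A)] closedT (@subsetT _ _)).
have semiT : subsemigroup [set: dual_space (luc A)] by [].
have [theta [thetaP iso]] := IA_isometry bai e1 semiT.
(* For the whole dual every right multiplier is some [R_Phi], so the intersection is all of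
   [M_r(A)]. *)
have MrE : capMr [set: dual_space (luc A)] = @right_multipliers R A.
  apply/seteqP; split=> [T [] //|T mT]; split=> //.
  have [Phi PT] := right_multiplier_rmult bai mT.
  by exists Phi => //; split=> //; exact: is_rmult_of_IA PT.
rewrite MrE in iso; exists theta; split=> //.
- by move=> Phi [_]; exact: thetaP.
- split.
    by split=> // a; exists 0; apply: bop_eqP => S; rewrite /= linear0.
  move=> k Phi Psi [_ IPhi] [_ IPsi]; split=> //.
  by apply: is_rmult_of_IA (is_rmult_of_linear k (thetaP _ IPhi) (thetaP _ IPsi)).
- split.
    move=> a b; rewrite !bop0E.
    by have := amulZr 0 a (0 : A); rewrite !scale0r => ->.
  move=> k T U mT mU a b; rewrite !bopDE !bopZE mT mU.
  by rewrite amulDr amulZr.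
Qed.
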